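(* Let $m$ and $n$ be non-negative integers. For an integer $k$ put $\Delta_n(k)=\binom{n}{k}-\binom{n}{k-1}$ (with $\binom{n}{i}=0$ for $i<0$). Then \begin{enumerate} \item $h_n(m,m)=\sum_{j\ge 0}\Delta_n(m-j)=\binom{n}{m}$ for $n\ge m$; \item $h_n(m,m+1)=\sum_{j\ge 0}\Delta_n(m-2j)=\binom{n-1}{m}$ for $n\ge m+1$; \item $h_n(m,m+2)=\sum_{j\ge 0}\Delta_n(m-3j)=\sum_{j=0}^{m}\binom{n-2j-2}{m-j}$ for $n\ge 2m+2$. \end{enumerate}
   Context: For integers $0\le m\le l\le n$, the truncated Boolean lattice $\mathcal{B}_n(m,l)$ is the poset, ordered by inclusion, of all subsets of $[n]=\{1,\dots,n\}$ of size at least $m$ and at most $l$. A chain $A_1\subset A_2\subset\cdots\subset A_c$ is saturated if $|A_{i+1}|=|A_i|+1$ for all $i$; a maximal chain of $\mathcal{B}_n(m,l)$ is a saturated chain with $l-m+1$ elements (from a set of size $m$ to a set of size $l$). A cutset in $\mathcal{B}_n(m,l)$ is a family $\mathcal{C}\subseteq\mathcal{B}_n(m,l)$ meeting every maximal chain of $\mathcal{B}_n(m,l)$. The width of a family of sets is the size of its largest antichain (family in which no member contains another). $h_n(m,l)$ denotes the minimum width of a cutset in $\mathcal{B}_n(m,l)$. *)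

(* Defs.v *)
From HB Require Import structures.
From mathcomp Require Import all_boot all_order all_algebra.
From mathcomp Require Import boolp classical_sets functions cardinality fsbigop.

Set Implicit Arguments.
Unset Strict Implicit.
Unset Printing Implicit Defensive.

Import Order.TTheory GRing.Theory Num.Theory.

Section TruncatedBooleanLattice.

(* The ground set [n] is 'I_n. *)
Variable n : nat.
Implicit Types (m l : nat) (F C : {set {set 'I_n}}).

Definition truncated_boolean m l : {set {set 'I_n}} :=
  [set A : {set 'I_n} | m <= #|A| <= l].

Definition saturated (c : seq {set 'I_n}) : bool :=
  sorted (fun A B : {set 'I_n} => (A \subset B) && (#|B| == #|A|.+1)) c.

(* The tuple lists the members of the chain from the smallest to the largest. *)
Definition maximal_chain m l (c : (l - m).+1.-tuple {set 'I_n}) : bool :=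
  saturated c && all (fun A => A \in truncated_boolean m l) c.

Definition cutset m l C : bool :=
  (C \subset truncated_boolean m l) &&
  [forall c : (l - m).+1.-tuple {set 'I_n},
    maximal_chain c ==> [exists A in C, A \in c]].

Definition antichain F : bool :=
  [forall A in F, forall B in F, (A \subset B) ==> (A == B)].

Definition width F : nat :=
  \max_(G : {set {set 'I_n}} | (G \subset F) && antichain G) #|G|.

Lemma cutset_truncated_boolean m l : cutset m l (truncated_boolean m l).
Proof.
rewrite /cutset subxx /=; apply/forallP => c; apply/implyP => /andP[_ /allP cB].
by apply/existsP; exists (thead c); rewrite cB ?mem_tnth.
Qed.

Definition h m l : nat :=
  width [arg min_(C < truncated_boolean m l | cutset m l C) width C].

Lemma hP m l :
  (exists2 C, cutset m l C & width C = h m l) /\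
  (forall C, cutset m l C -> h m l <= width C).
Proof.
rewrite /h; case: arg_minnP => [|C cutC minC].
  exact: cutset_truncated_boolean.
by split; first exists C.
Qed.

End TruncatedBooleanLattice.

Local Open Scope ring_scope.

Definition binz (n : nat) (k : int) : int :=
  if k is Posz i then 'C(n, i)%:Z else 0.

Definition Delta (n : nat) (k : int) : int := binz n k - binz n (k - 1).

(* Hence for d > 0 only the j with d * j <= m contribute to the sum of the
   Delta n (m - d * j) over all j: nat, which thus has finite support. *)
Lemma Delta_lt0 (n : nat) (k : int) : k < 0 -> Delta n k = 0.
Proof. by case: k. Qed.

(* Main.v *)
Require Import Defs.
From mathcomp Require Import all_boot all_order all_algebra.
From mathcomp Require Import perm zify ring.

(** Lower bounds. Each level of a cutset is an antichain, so it suffices to show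
    that some level of the cutset is large. For two levels, if the part at level
    [m] has fewer than C(n-1,m) members, then by Kruskal-Katona the upper shadow
    of the level-[m] sets outside the cutset has at least C(n-1,m) members, and
    this shadow lies in the cutset. For three levels, write f for the claimed
    width. If the bottom and top parts both have fewer than f members, the
    middle part contains the intersection of the upper shadow of the bottom sets
    outside the cutset with the lower shadow of the top ones, and
    Kruskal-Katona with the cascade n-1, n-3, n-5, ... bounds the size of that
    intersection below by exactly f.

    Upper bounds. For two levels take the [m]-sets avoiding 0 and the
    [m+1]-sets containing 0. For three levels read a set as a 0/1 word, cut the
    word into consecutive pairs, and look at the first pair that is not 01: keep
    a set of size [m], [m+1], [m+2] when this pair is 00, 10, 11 respectively
    and is one of the first [m+1] pairs. *)

Set Implicit Arguments.
Unset Strict Implicit.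
Unset Printing Implicit Defensive.

(** * The Kruskal-Katona theorem *)

Section Shadow.
Variable T : finType.
Implicit Types (A B : {set T}) (F : {set {set T}}) (e x y : T).

Definition shadow F : {set {set T}} :=
  [set B : {set T} | [exists y, (y \notin B) && (y |: B \in F)]].

Lemma shadowP F B :
  reflect (exists2 y : T, y \notin B & y |: B \in F) (B \in shadow F).
Proof.
by rewrite inE; apply: (iffP existsP) => [[y /andP[]]|[y yB yF]];
  exists y => //; apply/andP.
Qed.

Definition swap e x A : {set T} := tperm e x @^-1: A.

Lemma swapK e x : involutive (swap e x).
Proof. by move=> A; apply/setP => y; rewrite !inE tpermK. Qed.

Lemma card_swap e x A : #|swap e x A| = #|A|.
Proof. exact/card_preimset/perm_inj. Qed.

Lemma swapU1 e x y B : swap e x (y |: B) = tperm e x y |: swap e x B.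
Proof.
by apply/setP => z; rewrite !inE -(inj_eq (@perm_inj _ (tperm e x))) tpermK.
Qed.

Lemma swap_id e x A : (e \in A) = (x \in A) -> swap e x A = A.
Proof.
by move=> eqA; apply/setP => z; rewrite !inE; case: tpermP => [->|->|].
Qed.

(** The classical compression replacing [x] by [e], given by membership on the orbits of [swap e x]:
    if just one of two distinct swapped sets lies in [F], the one containing [e] is kept. *)
Definition shift e x F : {set {set T}} :=
  [set A : {set T} | if e \in A then (A \in F) || (swap e x A \in F)
           else (A \in F) && (swap e x A \in F)].

(** A family and its shift have the same union, and the same intersection, with their respective
    images under [swap e x]; these two sizes add up to twice the size of the family. *)
Lemma card_shift e x F : #|shift e x F| = #|F|.
Proof.
have dbl (H : {set {set T}}) : #|H| + #|H| =
    #|H :|: swap e x @^-1: H| + #|H :&: swap e x @^-1: H|.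
  by rewrite -{2}(card_preimset H (can_inj (swapK e x))) cardsUI.
apply: double_inj; rewrite -!addnn !dbl; congr (_ + _); apply: eq_card => A;
  rewrite !inE swapK tpermL; have [eqA|] := eqVneq (e \in A) (x \in A).
- by rewrite swap_id // -eqA; case: (e \in A); case: (A \in F).
- by case: (e \in A); case: (x \in A); case: (A \in F); case: (swap e x A \in F).
- by rewrite swap_id // -eqA; case: (e \in A); case: (A \in F).
- by case: (e \in A); case: (x \in A); case: (A \in F); case: (swap e x A \in F).
Qed.

Lemma shadow_shift e x F : shadow (shift e x F) \subset shift e x (shadow F).
Proof.
apply/subsetP => B /shadowP[y yB]; rewrite !inE.
have [->|ye] := eqVneq e y; last first.
  (* For [y != e], [B] and [y |: B] agree on [e], so the same branch of [shift] applies to both. *)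
  move=> /=; have yB' : tperm e x y \notin swap e x B by rewrite inE tpermK.
  case: ifP => eB.
    case/orP=> [yF|yF]; apply/orP; [left|right]; apply/existsP.
      by exists y; rewrite yB.
    by exists (tperm e x y); rewrite yB' -swapU1.
  case/andP=> yF yF'; apply/andP; split; apply/existsP.
    by exists y; rewrite yB.
  by exists (tperm e x y); rewrite yB' -swapU1.
rewrite (negbTE yB) /=.
(* Here [e] is [y]. If [x] is in [B], the swap fixes [y |: B], and deleting [y] or [x] from it
   yields [B] or its swap. Otherwise the swap fixes [B]. *)
have [xB|xB] := boolP (x \in B).
  rewrite (@swap_id y x (y |: B)) ?inE ?eqxx ?xB ?orbT // orbb => yF.
  apply/andP; split; apply/existsP; first by exists y; rewrite yB.
  exists x; rewrite inE tpermR yB /=; suff -> : x |: swap y x B = y |: B by [].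
  have xBE : B = x |: (B :\ x) by rewrite setD1K.
  have yx : y != x by apply: contraNneq yB => ->.
  rewrite {1}xBE swapU1 tpermR swap_id ?inE ?eqxx ?(negbTE yB) ?andbF //.
  by rewrite setUCA setD1K.
rewrite swapU1 tpermL swap_id ?(negbTE xB) ?(negbTE yB) // andbb.
by case/orP=> zF; apply/existsP; [exists y|exists x]; rewrite ?yB ?xB.
Qed.

(** Among the families of [k]-sets of the same size with no larger shadow, take one with the most
    members containing [e]. Shifting keeps these members, so by maximality it adds none. *)
Lemma exists_shifted e F (k : nat) :
    (forall A, A \in F -> #|A| = k) -> e \in cover F ->
  exists F', [/\ forall A, A \in F' -> #|A| = k, e \in cover F', #|F'| = #|F|,
    #|shadow F'| <= #|shadow F| &
    forall A x, A \in F' -> e \notin A -> x \in A -> swap e x A \in F'].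
Proof.
move=> Fk eF.
pose P (H : {set {set T}}) := [&& [forall A in H, #|A| == k], #|H| == #|F| &
  #|shadow H| <= #|shadow F|].
pose E := [set A : {set T} | e \in A].
have PF : P F.
  by rewrite /P eqxx leqnn !andbT; apply/forall_inP => A /Fk ->.
case: (@arg_maxnP _ F P (fun H => #|H :&: E|) PF) => H /and3P[Hk /eqP HF sH] Hmax.
have Ek : forall A, A \in H -> #|A| = k by move=> A /(forall_inP Hk)/eqP.
have subE x : H :&: E \subset shift e x H :&: E.
  apply/subsetP => A; rewrite !inE => /andP[AH eA].
  by rewrite eA AH.
have Pshift x : P (shift e x H).
  rewrite /P card_shift HF eqxx /=; apply/andP; split.
    apply/forall_inP => A; rewrite inE; case: ifP => _.
      by case/orP => /Ek <- //; rewrite card_swap.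
    by case/andP => /Ek <-.
  apply: leq_trans sH; rewrite -(card_shift e x (shadow H)).
  exact/subset_leq_card/shadow_shift.
exists H; split => //.
  case/bigcupP: eF => A AF eA.
  have : 0 < #|H :&: E|.
    apply: leq_trans (Hmax F PF); apply/card_gt0P; exists A.
    by rewrite !inE AF.
  by case/card_gt0P => B; rewrite !inE => /andP[BH eB]; apply/bigcupP; exists B.
move=> A x AH eA xA.
have /eqP eqE : H :&: E == shift e x H :&: E.
  by rewrite eqEcard subE; exact: Hmax.
suff: swap e x A \in H :&: E by rewrite inE => /andP[].
by rewrite eqE !inE tpermL swapK xA AH orbT.
Qed.

Definition link e F : {set {set T}} :=
  [set B : {set T} | (e \notin B) && (e |: B \in F)].

Definition deletion e F : {set {set T}} := [set A in F | e \notin A].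

Lemma setU1_inj e A B : e \notin A -> e \notin B -> e |: A = e |: B -> A = B.
Proof. by move=> eA eB eAB; rewrite -(setU1K eA) eAB setU1K. Qed.

Lemma card_deletion_link e F : #|F| = #|deletion e F| + #|link e F|.
Proof.
have -> : #|link e F| = #|[set e |: B | B in link e F]|.
  rewrite card_in_imset // => A B; rewrite !inE => /andP[eA _] /andP[eB _].
  exact: setU1_inj.
rewrite -(cardsID [set A : {set T} | e \notin A] F); congr (_ + _).
  by apply: eq_card => A; rewrite !inE.
apply: eq_card => A; rewrite !inE negbK; apply/andP/imsetP.
  by case=> eA AF; exists (A :\ e); rewrite ?inE ?eqxx setD1K.
by case=> B; rewrite inE => /andP[_ eBF] ->; rewrite !inE eqxx.
Qed.

(** The shadow is split by [e]: deleting [e] itself gives the link, deleting another element gives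
    the shadow of the deletion or, with [e] still present, that of the link. *)
Lemma card_shadow_link e F :
  #|link e F :|: shadow (deletion e F)| + #|shadow (link e F)| <= #|shadow F|.
Proof.
rewrite (card_deletion_link e (shadow F)); apply: leq_add; apply: subset_leq_card;
    apply/subsetP => B.
  rewrite !inE => /orP[/andP[eB eBF]|/existsP[y /andP[yB]]].
    by rewrite eB andbT; apply/existsP; exists e; rewrite eB.
  rewrite !inE negb_or => /andP[yBF /andP[_ ->]]; rewrite andbT.
  by apply/existsP; exists y; rewrite yB.
move=> /shadowP[y yB]; rewrite !inE negb_or => /andP[/andP[ey eB] yF].
rewrite eB /=; apply/existsP; exists y; rewrite setUCA yF !inE negb_or yB.
by rewrite eq_sym ey.
Qed.

(* Frankl's proof of the Kruskal-Katona theorem: after shifting towards [e],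
   the shadow of the sets avoiding [e] is contained in the link of [e]. The
   sequence [a] need not be decreasing, which frees the induction from the side
   conditions on cascades. *)
Theorem kruskal_katona (k : nat) (a : nat -> nat) F :
    (forall A, A \in F -> #|A| = k.+1) ->
    \sum_(j < k) 'C(a j, k.+1 - j) < #|F| ->
  \sum_(j < k) 'C(a j, k - j) < #|shadow F|.
Proof.
elim: k a F => [|k IHk] a F.
  rewrite !big_ord0 => F1 /card_gt0P[A AF]; apply/card_gt0P; exists set0.
  have /eqP/cards1P[x Ax] := F1 A AF.
  by apply/shadowP; exists x; rewrite ?inE // setU0 -Ax.
have [N] := ubnP #|F|; elim: N F a => // N IHN F a FN Fk ltF.
have /card_gt0P[A AF] : 0 < #|F| by apply: leq_trans ltF.
have /card_gt0P[e eA] : 0 < #|A| by rewrite (Fk A).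
have eF : e \in cover F by apply/bigcupP; exists A.
have [H [Hk eH HF sHF Hsh]] := exists_shifted Fk eF.
apply: leq_trans sHF; apply: leq_trans (card_shadow_link e H).
have sub : shadow (deletion e H) \subset link e H.
  apply/subsetP => B /shadowP[y yB]; rewrite !inE negb_or.
  move=> /andP[yBH /andP[ey eB]]; rewrite eB /=.
  have := Hsh _ y yBH; rewrite !inE negb_or ey eB eqxx => /(_ isT isT).
  by rewrite swapU1 tpermR swap_id // (negbTE eB) (negbTE yB).
have linkk B : B \in link e H -> #|B| = k.+1.
  by rewrite inE => /andP[eB /Hk]; rewrite cardsU1 eB => -[].
(* Pascal's rule splits each binomial over [a j] into two over [b j], one for each half of the
   family. At [a j = 0] the left side vanishes, since its lower index is positive. *)
pose b j := (a j).-1.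
have lt_link : \sum_(j < k.+1) 'C(b j, k.+1 - j) < #|link e H|.
  (* Were the link small, the deletion would be large enough for the induction on the size of the
     family, and its shadow would exceed the link containing it. *)
  rewrite ltnNge; apply/negP => le_link.
  have link_gt0 : 0 < #|link e H|.
    case/bigcupP: eH => B BH eB; apply/card_gt0P; exists (B :\ e).
    by rewrite !inE eqxx setD1K.
  have := card_deletion_link e H; rewrite HF => cF.
  have sub_le := subset_leq_card sub.
  suff : \sum_(j < k.+1) 'C(b j, k.+1 - j) < #|shadow (deletion e H)| by lia.
  apply: IHN => [|B|]; [lia|by rewrite inE => /andP[/Hk]|].
  suff : \sum_(j < k.+1) 'C(b j, k.+2 - j) + \sum_(j < k.+1) 'C(b j, k.+1 - j)
      <= \sum_(j < k.+1) 'C(a j, k.+2 - j) by lia.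
  rewrite -big_split /=; apply: leq_sum => j _; have jk := ltn_ord j.
  rewrite /b subSn; last by lia.
  by case: (a j) => [|c] /=; [rewrite !bin0n; lia|rewrite binS].
(* The last term is C(b k, 0) = 1, which absorbs the strict inequality for [k]. *)
have sl : \sum_(j < k.+1) 'C(b j, k - j) <= #|shadow (link e H)|.
  rewrite big_ord_recr /= subnn bin0 addn1; apply: IHk => //.
  apply: leq_ltn_trans lt_link.
  by rewrite big_ord_recr /= leq_addr.
rewrite (setUidPl sub).
suff : \sum_(j < k.+1) 'C(a j, k.+1 - j) <=
    \sum_(j < k.+1) 'C(b j, k.+1 - j) + \sum_(j < k.+1) 'C(b j, k - j) by lia.
rewrite -big_split /=; apply: leq_sum => j _; have jk := ltn_ord j.
  rewrite /b subSn; last by lia.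
by case: (a j) => [|c] /=; [rewrite !bin0n; lia|rewrite binS].
Qed.

End Shadow.

(** * Cutsets *)

Lemma sum_bin_pairs_recl n m :
  \sum_(j < m.+2) 'C(n.+2 - 2 * j - 2, m.+1 - j) =
  'C(n, m.+1) + \sum_(j < m.+1) 'C(n - 2 * j - 2, m - j).
Proof.
rewrite big_ord_recl; congr addn; first by congr 'C(_, _); rewrite /=; lia.
by apply: eq_bigr => j _; rewrite lift0; congr 'C(_, _); lia.
Qed.

Lemma sum_bin_odd_recl n p k :
  \sum_(j < p.+1) 'C(n.+2 - 1 - 2 * j, k.+1 - j) =
  'C(n.+1, k.+1) + \sum_(j < p) 'C(n - 1 - 2 * j, k - j).
Proof.
rewrite big_ord_recl; congr addn.
by apply: eq_bigr => j _; rewrite lift0; congr 'C(_, _); lia.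
Qed.

(** If the cutset has fewer bottom sets than the first sum, those outside it outnumber the second
    sum, the Kruskal-Katona threshold for their complements. *)
Lemma sum_bin_complement_eq n m : 2 * m + 2 <= n ->
  'C(n, m) = \sum_(j < m.+1) 'C(n - 2 * j - 2, m - j) +
             \sum_(j < m) 'C(n - 1 - 2 * j, n - m - j).
Proof.
elim: m n => [|m IHm] n mn; first by rewrite big_ord1 big_ord0 !bin0.
case: n mn => [|[|n]] mn; [lia..|]; have /IHm IH : 2 * m + 2 <= n by lia.
have nE : n.+2 - m.+1 = (n - m).+1 by lia.
rewrite sum_bin_pairs_recl nE sum_bin_odd_recl addnACA -IH.
have -> : 'C(n.+1, (n - m).+1) = 'C(n.+1, m).
  by rewrite -[RHS]bin_sub; [congr 'C(_, _); lia|lia].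
by rewrite binS binS; lia.
Qed.

(** The analogous threshold for the top level. The inductive step is exact; only the base case
    [m = 0] loses something. *)
Lemma sum_bin_complement_le n m : 2 * m + 2 <= n ->
  \sum_(j < m.+1) 'C(n - 2 * j - 2, m - j) +
    \sum_(j < m.+1) 'C(n - 1 - 2 * j, m.+2 - j) <= 'C(n, m.+2).
Proof.
elim: m n => [|m IHm] [|[|n]] // mn; rewrite ?addn0 // in mn *; [|lia|].
  by rewrite !big_ord1 muln0 !subn0 subn1 bin0 !binS bin0; lia.
have /IHm IH : 2 * m + 2 <= n by lia.
rewrite sum_bin_pairs_recl sum_bin_odd_recl addnACA.
have := binS n.+1 m.+2; have := binS n m.+1; lia.
Qed.

(** The sums on the right are the Kruskal-Katona bounds for the two shadows; the 2 is what their two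
    strict inequalities gain. *)
Lemma sum_bin_shadows n m : 2 * m + 2 <= n ->
  \sum_(j < m.+1) 'C(n - 2 * j - 2, m - j) + 'C(n, m.+1) =
  \sum_(j < m) 'C(n - 1 - 2 * j, n - m.+1 - j) +
    \sum_(j < m.+1) 'C(n - 1 - 2 * j, m.+1 - j) + 2.
Proof.
elim: m n => [|m IHm] [|[|n]] // mn; rewrite ?addn0 // in mn *; [|lia|].
  by rewrite !big_ord1 big_ord0 muln0 !subn0 subn1 bin0 !bin1; lia.
have /IHm IH : 2 * m + 2 <= n by lia.
have nE : n.+2 - m.+2 = (n - m.+1).+1 by lia.
rewrite sum_bin_pairs_recl nE !sum_bin_odd_recl.
have := binS n.+1 m.+1.
have -> : 'C(n.+1, (n - m.+1).+1) = 'C(n.+1, m.+1).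
  by rewrite -[RHS]bin_sub; [congr 'C(_, _); lia|lia].
lia.
Qed.

Section Cutsets.
Variable n : nat.
Implicit Types (A B D : {set 'I_n}) (F G C : {set {set 'I_n}}).

(** * Levels, widths and upper shadows *)

Lemma card_le_width F G : G \subset F -> antichain G -> #|G| <= width F.
Proof.
by move=> GF aG; apply: (@leq_bigmax_cond _ _ (fun G => #|G|)); rewrite GF.
Qed.

Definition level (k : nat) : {set {set 'I_n}} := [set A : {set 'I_n} | #|A| == k].

Lemma card_level k : #|level k| = 'C(n, k).
Proof. by rewrite /level card_draws card_ord. Qed.

Lemma card_levelI_le_width F k : #|F :&: level k| <= width F.
Proof.
apply: card_le_width; first exact: subsetIl.
apply/forall_inP => A; rewrite !inE => /andP[_ /eqP Ak].
apply/forall_inP => B; rewrite !inE => /andP[_ /eqP Bk].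
by apply/implyP => AB; rewrite eqEcard AB Ak Bk leqnn.
Qed.

(** Members of an antichain lying in [Fs j] have distinct traces on [Q j], since equal traces force
    comparability, and each trace is a [k j]-subset of [Q j]. *)
Lemma width_le_sum_bin t (Fs : 'I_t -> {set {set 'I_n}}) (Q : 'I_t -> {set 'I_n})
    (k : 'I_t -> nat) F :
    F \subset \bigcup_j Fs j ->
    (forall j A, A \in Fs j -> #|A :&: Q j| = k j) ->
    (forall j A B, A \in Fs j -> B \in Fs j -> A :&: Q j = B :&: Q j ->
       (A \subset B) || (B \subset A)) ->
  width F <= \sum_j 'C(#|Q j|, k j).
Proof.
move=> FFs cQ cmp; apply/bigmax_leqP => G /andP[GF /forall_inP aG].
have : #|G| <= \sum_j #|G :&: Fs j|.
  apply: (@leq_trans #|\bigcup_j (G :&: Fs j)|).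
    by rewrite -big_distrr /= (setIidPl (subset_trans GF FFs)).
  elim/big_ind2: _ => [|p X q Y le1 le2|//]; first by rewrite cards0.
  apply: leq_trans (leq_add le1 le2); rewrite -cardsUI; exact: leq_addr.
move/leq_trans; apply; apply: leq_sum => j _.
have /card_in_imset <- : {in G :&: Fs j &, injective (fun A => A :&: Q j)}.
  move=> A B; rewrite !inE => /andP[AG AF] /andP[BG BF] AB.
  case/orP: (cmp _ _ _ AF BF AB) => sub.
    exact/eqP/(implyP (forall_inP (aG A AG) B BG)).
  exact/esym/eqP/(implyP (forall_inP (aG B BG) A AG)).
rewrite -(cards_draws (Q j)); apply/subset_leq_card/subsetP => _ /imsetP[A + ->].
by rewrite !inE => /andP[_ AF]; rewrite subsetIr (cQ _ _ AF) /=.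
Qed.

Lemma cutsetP m l C :
  reflect (C \subset truncated_boolean n m l /\
    forall c, size c = (l - m).+1 -> saturated c ->
      {subset c <= truncated_boolean n m l} -> exists2 A, A \in C & A \in c)
  (cutset m l C).
Proof.
apply: (iffP andP) => -[sC cC]; split=> //.
  move=> c /eqP sz sat /allP ac; have := forallP cC (Tuple sz).
  by rewrite /maximal_chain /= sat ac => /existsP[A /andP[]]; exists A.
apply/forallP => c; apply/implyP => /andP[sat /allP ac].
have [|A AC Ac] := cC c _ sat ac; first by rewrite size_tuple.
by apply/existsP; exists A; rewrite AC.
Qed.

Definition upper_shadow F : {set {set 'I_n}} :=
  [set B : {set 'I_n} | [exists y, (y \in B) && (B :\ y \in F)]].

Lemma card_upper_shadow F : #|upper_shadow F| = #|shadow (@setC 'I_n @^-1: F)|.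
Proof.
rewrite -(card_preimset (upper_shadow F) (@setC_inj 'I_n)).
apply: eq_card => B; rewrite !inE; apply: eq_existsb => y.
by rewrite !inE setCU setIC setDE.
Qed.

(** Complementation turns upper shadows of [m]-sets into shadows of sets of size n-m = k+1. *)
Lemma card_upper_shadow_gt m k (a : nat -> nat) F : m + k.+1 = n ->
    (forall A, A \in F -> #|A| = m) ->
    \sum_(j < k) 'C(a j, k.+1 - j) < #|F| ->
  \sum_(j < k) 'C(a j, k - j) < #|upper_shadow F|.
Proof.
move=> nE Fm; rewrite card_upper_shadow -(card_preimset F (@setC_inj 'I_n)).
apply: kruskal_katona => A; rewrite inE => /Fm Am.
by have := cardsC A; rewrite card_ord; lia.
Qed.

Lemma mem_level_setD C k A : A \in level k :\: C -> #|A| = k.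
Proof. by rewrite !inE => /andP[_ /eqP]. Qed.

Lemma card_level_setD C k : #|level k :\: C| = 'C(n, k) - #|C :&: level k|.
Proof. by rewrite cardsD card_level setIC. Qed.

Lemma cutset_h_le m l C w : cutset m l C -> width C <= w -> h n m l <= w.
Proof. by move=> cutC; apply: leq_trans; have [_] := hP n m l; apply. Qed.

Lemma le_h m l w : (forall C, cutset m l C -> w <= width C) -> w <= h n m l.
Proof. by have [[C cutC <-] _] := hP n m l; apply. Qed.

(** The maximal chains are the single [m]-sets, so the whole level is the only cutset. *)
Lemma h_level m : h n m m = 'C(n, m).
Proof.
apply/eqP; rewrite eqn_leq; apply/andP; split.
  apply: (cutset_h_le (cutset_truncated_boolean n m m)).
  apply: leq_trans (@width_le_sum_bin 1 (fun=> level m) (fun=> setT) (fun=> m) _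
    _ _ _) _.
  - apply/subsetP => A; rewrite inE -eqn_leq => mA.
    by apply/bigcupP; exists ord0; rewrite ?inE // eq_sym.
  - by move=> _ A; rewrite inE setIT => /eqP.
  - by move=> _ A B _ _; rewrite !setIT => ->; rewrite subxx.
  - by rewrite big_ord1 cardsT card_ord.
apply: le_h => C /cutsetP[_ cutC].
apply: leq_trans (card_levelI_le_width C m); rewrite -card_level.
apply/subset_leq_card/subsetP => A Am; rewrite inE Am andbT.
have [| |A'|B] := cutC [:: A]; rewrite ?subnn //.
  by move: Am; rewrite !inE => /eqP Am /eqP->; rewrite Am leqnn.
by move=> BC; rewrite inE => /eqP<-.
Qed.

(** * Lower bounds for two and three levels *)

Lemma subset_upper_shadow_cutset m C : cutset m (m + 1) C ->
  upper_shadow (level m :\: C) \subset C :&: level (m + 1).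
Proof.
move=> /cutsetP[_ cutC]; apply/subsetP => B.
rewrite !inE => /existsP[y /andP[yB]]; rewrite !inE => /andP[AC /eqP Am].
have Bm : #|B| = m.+1 by rewrite (cardsD1 y) yB Am.
rewrite Bm addn1 eqxx andbT.
have [| |A'|D DC] := cutC [:: B :\ y; B]; rewrite /= ?Bm ?Am ?subsetDl ?eqxx //.
- by rewrite addKn.
- by rewrite !inE => /orP[]/eqP->; rewrite ?Am ?Bm; lia.
by rewrite !inE => /orP[]/eqP DE; [rewrite -DE DC in AC|rewrite -DE].
Qed.

Lemma bin_pred_le_h m : m + 1 <= n -> 'C(n - 1, m) <= h n m (m + 1).
Proof.
move=> mn; apply: le_h => C cutC.
have := card_levelI_le_width C m; have := card_levelI_le_width C (m + 1).
have := subset_leq_card (subset_upper_shadow_cutset cutC).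
have [|ltS] := leqP 'C(n - 1, m) #|C :&: level m|; first lia.
suff : 'C(n - 1, m) <= #|upper_shadow (level m :\: C)| by lia.
(* A cascade with the single nonzero entry n-1: the threshold is C(n-1, k+1) = C(n, m) - C(n-1, m),
   and the resulting bound is C(n-1, k) = C(n-1, m). *)
pose k := n - m - 1; pose a j := if j is 0 then n - 1 else 0.
have nE : 'C(n, m) = 'C(n - 1, m) + 'C(n - 1, k.+1).
  case: n mn @k {a cutC ltS C} => [|p]; rewrite ?addn1 // ltnS subn1 => mp k.
  case: m mp @k => [|m'] mp k.
    by rewrite !bin0 [X in _ + X]bin_small //; lia.
  by rewrite subn1 /= binS -(bin_sub (ltnW mp)); congr (_ + 'C(_, _)); lia.
have := @card_upper_shadow_gt m k a (level m :\: C) ltac:(lia)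
  (@mem_level_setD C m).
have kE : n = m + k.+1 by lia.
(* For [k = 0] the cascade is empty, but then C(n-1, m) = 1 and a nonempty upper shadow suffices. *)
rewrite card_level_setD; case: k @a nE kE => [|k'] a nE kE.
  have nm : m = n - 1 by lia.
  by rewrite !big_ord0 nE; rewrite -nm binn in ltS *; lia.
have k'E : 'C(n - 1, k'.+1) = 'C(n - 1, m).
  by rewrite -[in RHS]bin_sub; [congr 'C(_, _); lia|lia].
rewrite !big_ord_recl !big1 /= => [|i _|i _]; rewrite ?subn0 ?k'E.
- by rewrite !addn0 => lt_sh; apply: ltnW (lt_sh _); rewrite nE ltn_subRL ltn_add2r.
- by rewrite bin0n; have := ltn_ord i; rewrite /bump; lia.
- by rewrite bin0n; have := ltn_ord i; rewrite /bump; lia.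
Qed.

(** Such a set is the middle of a maximal chain whose two ends miss the cutset. *)
Lemma subset_shadows_cutset m C : cutset m (m + 2) C ->
  upper_shadow (level m :\: C) :&: shadow (level (m + 2) :\: C)
    \subset C :&: level (m + 1).
Proof.
move=> /cutsetP[_ cutC]; apply/subsetP => B; rewrite !inE.
case/andP=> /existsP[y /andP[yB]] + /existsP[z /andP[zB]].
rewrite !inE => /andP[AC /eqP Am] /andP[DC /eqP Dm].
have Bm : #|B| = m.+1 by rewrite (cardsD1 y) yB Am.
rewrite Bm addn1 eqxx andbT.
have [| |A'|E EC] := cutC [:: B :\ y; B; z |: B];
  rewrite /= ?Bm ?Am ?Dm ?subsetDl ?subsetUr ?addn2 ?eqxx //.
- by rewrite subSn ?leq_addr // subSn // subnn.
- by rewrite !inE => /or3P[]/eqP->; rewrite ?Am ?Bm ?Dm; lia.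
by rewrite !inE => /or3P[]/eqP EE;
  [rewrite -EE EC in AC|rewrite -EE|rewrite -EE EC in DC].
Qed.


Lemma sum_bin_le_h m : 2 * m + 2 <= n ->
  \sum_(j < m.+1) 'C(n - 2 * j - 2, m - j) <= h n m (m + 2).
Proof.
move=> mn; apply: le_h => C cutC.
have := card_levelI_le_width C m; have := card_levelI_le_width C (m + 1).
have := card_levelI_le_width C (m + 2).
have := subset_leq_card (subset_shadows_cutset cutC).
set f := \sum_(j < m.+1) _.
have [|ltR] := leqP f #|C :&: level (m + 2)|; first lia.
have [|ltS] := leqP f #|C :&: level m|; first lia.
set U := upper_shadow _; set W := shadow _.
(* Both shadows lie in level m+1, so inclusion-exclusion bounds their intersection. *)
suff : f + 'C(n, m.+1) <= #|U| + #|W|.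
  rewrite -cardsUI; suff : #|U :|: W| <= 'C(n, m.+1) by lia.
  rewrite -card_level; apply/subset_leq_card/subsetP => B; rewrite !inE.
  case/orP=> /existsP[y /andP[yB]]; rewrite !inE => /andP[_].
    by rewrite [#|B|](cardsD1 y) yB => /eqP ->.
  by rewrite cardsU1 yB addn2 eqSS.
rewrite sum_bin_shadows // addn2 -addnS -addSn; apply: leq_add.
  have mk : m <= n - m - 1 by lia.
  pose a j := n - 1 - 2 * j.
  (* The cascade for the complements has n-m-1 entries. From index [m] on, its terms vanish in the
     threshold and are dropped from the bound. *)
  have split_sum (F : nat -> nat) : \sum_(j < n - m - 1) F j =
      \sum_(j < m) F j + \sum_(m <= j < n - m - 1) F j.
    by rewrite -!(big_mkord xpredT) -big_cat_nat.
  apply: (@leq_ltn_trans (\sum_(j < n - m - 1) 'C(a j, n - m - 1 - j))).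
    rewrite (split_sum (fun j => 'C(a j, n - m - 1 - j))) -subnDA addn1.
    exact: leq_addr.
  apply: (@card_upper_shadow_gt m); [lia|exact: mem_level_setD|].
  have -> : (n - m - 1).+1 = n - m by lia.
  rewrite (split_sum (fun j => 'C(a j, n - m - j))) [X in _ + X]big_nat_cond
    [X in _ + X]big1.
    have := sum_bin_complement_eq mn; rewrite -/f card_level_setD /a => ->.
    by rewrite addn0 ltn_subRL ltn_add2r.
  by move=> j; rewrite andbT /a => jm; apply: bin_small; lia.
apply: (kruskal_katona (a := fun j => n - 1 - 2 * j)).
  by move=> A /mem_level_setD; rewrite addn2.
have := sum_bin_complement_le mn; rewrite -/f card_level_setD.
by rewrite addn2 in ltR *; lia.
Qed.

(** * Upper bounds by explicit cutsets *)

Lemma mem_truncated m l A : (A \in truncated_boolean n m l) = (m <= #|A| <= l).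
Proof. by rewrite inE. Qed.

Lemma setD1_id (x : 'I_n) A : x \notin A -> A :\ x = A.
Proof. by move=> xA; apply/setDidPl; rewrite disjoint_sym disjoints1. Qed.

(** In a chain of two sets the smaller is kept if it avoids [x0], the larger otherwise. Sets with
    the same trace off [x0] are comparable, and the traces are [m]-sets. *)
Lemma h_le_bin_pred m : m + 1 <= n -> h n m (m + 1) <= 'C(n - 1, m).
Proof.
move=> mn; have n_gt0 : 0 < n by lia.
pose x0 := Ordinal n_gt0.
pose C := [set A : {set 'I_n} | #|A| == m + (x0 \in A)].
have CD A : A \in C -> #|A :\ x0| = m.
  by rewrite inE [#|A|](cardsD1 x0) addnC eqn_add2r => /eqP.
apply: (@cutset_h_le _ _ C).
  apply/cutsetP; split.
    by apply/subsetP => A; rewrite !inE => /eqP ->; case: (x0 \in A); lia.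
  move=> [|A [|B [|? ?]]] //=; rewrite ?addKn // /saturated /=.
  move=> _ /andP[/andP[AB /eqP Bm] _] sub.
  have := sub A; have := sub B; rewrite !mem_truncated !inE !eqxx orbT.
  move=> /(_ isT) Bl /(_ isT) Al; have {}Bm : #|B| = #|A|.+1 by [].
  have Am : #|A| = m by lia.
  have [x0A|x0A] := boolP (x0 \in A); last first.
    by exists A; rewrite !inE ?eqxx // (negbTE x0A) addn0 Am.
  by exists B; rewrite !inE ?eqxx ?orbT // (subsetP AB) // Bm Am addn1.
apply: leq_trans (@width_le_sum_bin 1 (fun=> C) (fun=> ~: [set x0]) (fun=> m) _
    _ _ _) _.
- by rewrite big_ord1.
- by move=> _ A /CD; rewrite setDE.
- move=> _ A B _ _; rewrite -!setDE => AB.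
  have [x0B|x0B] := boolP (x0 \in B); last first.
    by rewrite -(setD1_id x0B) -AB subD1set orbT.
  have [x0A|x0A] := boolP (x0 \in A); last first.
    by rewrite -(setD1_id x0A) AB subD1set.
  by rewrite -(setD1K x0A) AB setD1K // subxx.
by rewrite big_ord1 cardsC1 card_ord subn1.
Qed.

Lemma card_ord_lt (P : pred nat) b : b <= n ->
  #|[set x : 'I_n | P x && (x < b)]| = \sum_(i < b) P i.
Proof.
move=> bn; rewrite -sum1dep_card -(big_ord_widen_cond _ P (fun=> 1) bn).
by rewrite big_mkcond; apply: eq_bigr => i _; case: (P i).
Qed.

(* Bits [2i], [2i+1] for [i < j] read 01, and bits [2j], [2j+1] read 00, 10, 11
   for [t = 0, 1, 2]. *)
Definition pattern (j t i : nat) : bool :=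
  odd i && (i < 2 * j) || (2 * j <= i < 2 * j + t).

Definition trace_below (b : nat) (P : pred nat) : {set {set 'I_n}} :=
  [set A : {set 'I_n} | [forall x : 'I_n, (x < b) ==> ((x \in A) == P x)]].

Lemma trace_belowP b (P : pred nat) A :
  reflect (forall x : 'I_n, x < b -> (x \in A) = P x) (A \in trace_below b P).
Proof.
rewrite inE; apply: (iffP forallP) => [H x xb|H x]; last first.
  by apply/implyP => /H ->.
by apply/eqP; have /implyP := H x; apply.
Qed.

Lemma sum_odd j : \sum_(i < 2 * j) odd i = j.
Proof.
elim: j => [|j IHj]; first by rewrite big_ord0.
by rewrite mulnS !big_ord_recr /= IHj; lia.
Qed.

Lemma sum_pattern j t : t <= 2 -> \sum_(i < 2 * j + 2) pattern j t i = j + t.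
Proof.
move=> t2; rewrite addn2 !big_ord_recr /= /pattern.
under eq_bigr => i _.
  rewrite ltn_ord andbT [2 * j <= i]leqNgt ltn_ord orbF.
  over.
by rewrite sum_odd; lia.
Qed.

(** Each leading pair 01 contributes an element, so no [m]-set starts with m+1 of them. This bounds
    the position of the first other pair. *)
Lemma card_trace_below_gt m : 2 * m + 2 <= n -> forall A,
  A \in trace_below (2 * m + 2) (pattern m.+1 0) -> m < #|A|.
Proof.
move=> mn A /trace_belowP AP.
rewrite -{1}[m.+1]sum_odd mulnS addnC -(card_ord_lt odd mn).
apply/subset_leq_card/subsetP => x; rewrite inE => /andP[ox xb].
by rewrite AP // /pattern ox mulnS addnC xb.
Qed.

(** The prefix carries j+t elements, so a set of size m+t has m-j elements beyond it, whatever [t]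
    is. *)
Lemma card_setI_ge j t A : t <= 2 -> 2 * j + 2 <= n ->
  A \in trace_below (2 * j + 2) (pattern j t) ->
  #|A :&: [set x : 'I_n | 2 * j + 2 <= x]| + (j + t) = #|A|.
Proof.
move=> t2 jn /trace_belowP AP; rewrite -(sum_pattern j t2) -(card_ord_lt _ jn).
rewrite -(cardsID [set x : 'I_n | 2 * j + 2 <= x] A); congr (_ + _).
apply: eq_card => x; rewrite !inE -ltnNge andbC.
by have [/AP->|] := boolP (x < 2 * j + 2).
Qed.

Section PairConstruction.
Variable m : nat.
Hypothesis mn : 2 * m + 2 <= n.

Let part j : {set {set 'I_n}} :=
  [set A : {set 'I_n} |
    [exists t : 'I_3,
      (#|A| == m + t) && (A \in trace_below (2 * j + 2) (pattern j t))]].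

Let C : {set {set 'I_n}} := \bigcup_(j < m.+1) part j.

Lemma part_cutset : cutset m (m + 2) C.
Proof.
apply/cutsetP; split.
  apply/subsetP => A /bigcupP[j _]; rewrite !inE => /existsP[t /andP[/eqP-> _]].
  by have := ltn_ord t; lia.
move=> [|A [|B [|D [|? ?]]]] //=; rewrite ?addKn //.
rewrite /saturated /= => _ /and3P[/andP[AB /eqP Bm] /andP[BD /eqP Dm] _] sub.
have := sub A; have := sub D; rewrite !mem_truncated !inE !eqxx !orbT.
move=> /(_ isT) Dl /(_ isT) Al.
have {}Bm : #|B| = #|A|.+1 by [].
have {}Dm : #|D| = #|B|.+1 by [].
have Am : #|A| = m by lia.
pose Q j E := E \in trace_below (2 * j) (pattern j 0).
pose P j := [&& Q j A, Q j B & Q j D].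
(* Take the longest run of pairs 01 with which all three sets begin; it has at most [m] pairs
   because [A] has only [m] elements. *)
have [j jm /andP[Pj nPj]] : exists2 j, j <= m & P j && ~~ P j.+1.
  have nPm : ~~ P m.+1.
    apply/negP => /and3P[+ _ _]; rewrite /Q mulnS addnC => /(card_trace_below_gt mn).
    by rewrite Am ltnn.
  have P0 : P 0 by apply/and3P; split; apply/trace_belowP.
  have ex : exists i, ~~ P i by exists m.+1.
  case: (ex_minnP ex) => [[|j] nPj jmin]; first by rewrite P0 in nPj.
  exists j; first exact: (jmin _ nPm).
  rewrite nPj andbT; apply/negPn/negP => /jmin; lia.
have jn : 2 * j + 2 <= n by lia.
have [n0 n1] : 2 * j < n /\ 2 * j + 1 < n by lia.
pose x0 := Ordinal n0; pose x1 := Ordinal n1.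
have splitx (x : 'I_n) : x < 2 * j + 2 -> [\/ x < 2 * j, x = x0 | x = x1].
  move=> xj; have [|] := ltnP x (2 * j); first by constructor 1.
  rewrite leq_eqVlt => /orP[/eqP xE|xE]; first by constructor 2; apply/val_inj.
  by constructor 3; apply/val_inj => /=; lia.
have ext (E : {set 'I_n}) t : t <= 2 -> E \in trace_below (2 * j) (pattern j 0) ->
    (x0 \in E) = (0 < t) -> (x1 \in E) = (1 < t) ->
    E \in trace_below (2 * j + 2) (pattern j t).
  move=> t2 /trace_belowP EP E0 E1; apply/trace_belowP => x /splitx[xj| ->| ->].
  - by rewrite EP // /pattern; lia.
  - by rewrite E0 /pattern /=; lia.
  - by rewrite E1 /pattern /=; lia.
have inC (E : {set 'I_n}) (t : 'I_3) : #|E| = m + t ->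
    E \in trace_below (2 * j + 2) (pattern j t) -> E \in C.
  move=> Em EP; have jm' : j < m.+1 by [].
  apply/bigcupP; exists (Ordinal jm') => //; rewrite inE; apply/existsP.
  by exists t; rewrite Em eqxx.
case/and3P: Pj => PA PB PD.
have := subsetP AB x0; have := subsetP AB x1.
have := subsetP BD x0; have := subsetP BD x1.
have ext1 E : Q j E -> (x0 \in E) = false -> (x1 \in E) = true -> Q j.+1 E.
  move=> /trace_belowP EP E0 E1; apply/trace_belowP => x; rewrite mulnS addnC.
  move=> /splitx[xj| ->| ->].
  - by rewrite EP // /pattern; lia.
  - by rewrite E0 /pattern /=; lia.
  - by rewrite E1 /pattern /=; lia.
(* The next pair increases along the chain: [A] reads 00, or [D] reads 11, or [B] reads 10, or all
   read 01, which the choice of [j] excludes. *)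
have bits (a0 a1 b0 b1 d0 d1 : bool) :
    (b1 -> d1) -> (b0 -> d0) -> (a1 -> b1) -> (a0 -> b0) ->
    [\/ a0 = false /\ a1 = false, d0 = true /\ d1 = true,
        b0 = true /\ b1 = false |
        [/\ a0 = false, b0 = false & d0 = false] /\
        [/\ a1 = true, b1 = true & d1 = true]].
  move: a0 a1 b0 b1 d0 d1 => [] [] [] [] [] [] h1 h2 h3 h4;
    first [by constructor 1 | by constructor 2 | by constructor 3
          | by constructor 4 | by have := h1 isT | by have := h2 isT
          | by have := h3 isT | by have := h4 isT].
move=> BD1 BD0 AB1 AB0.
case: (bits _ _ _ _ _ _ BD1 BD0 AB1 AB0) => [[E0 E1]|[E0 E1]|[E0 E1]|[]].
- exists A; rewrite ?inE ?eqxx //; apply: (inC _ (@Ordinal 3 0 isT)).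
    by rewrite addn0.
  exact: ext.
- exists D; rewrite ?inE ?eqxx ?orbT //; apply: (inC _ (@Ordinal 3 2 isT)).
    by rewrite Dm Bm Am addn2.
  exact: ext.
- exists B; rewrite ?inE ?eqxx ?orbT //; apply: (inC _ (@Ordinal 3 1 isT)).
    by rewrite Bm Am addn1.
  exact: ext.
by case=> A0 B0 D0 [A1 B1 D1]; case/negP: nPj; apply/and3P; split; apply: ext1.
Qed.

Lemma h_le_sum_bin : h n m (m + 2) <= \sum_(j < m.+1) 'C(n - 2 * j - 2, m - j).
Proof.
apply: (cutset_h_le part_cutset).
apply: leq_trans (@width_le_sum_bin m.+1 part
   (fun j => [set x : 'I_n | 2 * j + 2 <= x]) (fun j => m - j) _ _ _ _) _ => //.
- move=> j A; rewrite inE => /existsP[t /andP[/eqP Am /card_setI_ge]].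
  by have := ltn_ord t; have := ltn_ord j => jm t3 /(_ ltac:(lia) ltac:(lia)); lia.
(* The patterns 00, 10, 11 increase with [t], so sets of one part that agree beyond the prefix are
   nested. *)
- move=> j; suff sub A B (s t : 'I_3) : s <= t ->
      A \in trace_below (2 * j + 2) (pattern j s) ->
      B \in trace_below (2 * j + 2) (pattern j t) ->
      A :&: [set x : 'I_n | 2 * j + 2 <= x] =
        B :&: [set x : 'I_n | 2 * j + 2 <= x] ->
      A \subset B.
    move=> A B; rewrite !inE => /existsP[s /andP[_ As]] /existsP[t /andP[_ Bt]] AB.
    have [st|ts] := leqP s t; first by rewrite (sub _ _ _ _ st As Bt AB).
    by rewrite (sub _ _ _ _ (ltnW ts) Bt As (esym AB)) orbT.
  move=> st /trace_belowP As /trace_belowP Bt AB; apply/subsetP => x.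
  have [xj|xj] := ltnP x (2 * j + 2); first by rewrite As // Bt // /pattern; lia.
  by move/setP/(_ x): AB; rewrite !inE xj !andbT => ->.
apply: leq_sum => j _; rewrite -(@leq_add2r 0) !addn0.
have jn : 2 * j + 2 <= n by have := ltn_ord j; lia.
have := cardsC [set x : 'I_n | true && (x < 2 * j + 2)].
rewrite (card_ord_lt xpredT jn) sum1_card card_ord card_ord => cE.
have <- : #|~: [set x : 'I_n | true && (x < 2 * j + 2)]| = n - 2 * j - 2 by lia.
apply: leq_bin2l; apply/subset_leq_card/subsetP => x; rewrite !inE; lia.
Qed.

End PairConstruction.

End Cutsets.

(** * The sums of the [Delta n k] *)

From mathcomp Require Import boolp classical_sets functions cardinality fsbigop.
Import Order.TTheory GRing.Theory Num.Theory.
Local Open Scope classical_set_scope.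
Local Open Scope ring_scope.

Lemma binz_lt0 n (k : int) : k < 0 -> binz n k = 0.
Proof. by case: k. Qed.

Lemma binzS n (k : int) : binz n.+1 k = binz n k + binz n (k - 1).
Proof.
case: k => [[|k]|k]; first by rewrite /= !bin0.
  have -> : k.+1%:Z - 1 = k%:Z by lia.
  by rewrite /= binS PoszD.
by have -> : Negz k - 1 = Negz k.+1 by lia.
Qed.

(** The final term has the negative index m - d N and vanishes. *)
Lemma telescope_binz n m d N : (m < d * N)%N ->
  \sum_(0 <= j < N)
     (binz n (m%:Z - d%:Z * j%:Z) - binz n (m%:Z - d%:Z * j%:Z - d%:Z)) =
  'C(n, m)%:Z.
Proof.
move=> mN; under eq_bigr => j _.
  have -> : m%:Z - d%:Z * j%:Z - d%:Z = m%:Z - d%:Z * j.+1%:Z by lia.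
  rewrite -opprB; over.
rewrite sumrN telescope_sumr // mulr0 subr0 binz_lt0 ?sub0r ?opprK //; lia.
Qed.

Lemma fsum_Delta n m d : (0 < d)%N ->
  \sum_(j \in [set: nat]) Delta n (m%:Z - d%:Z * j%:Z) =
  \sum_(0 <= j < m.+1) Delta n (m%:Z - d%:Z * j%:Z).
Proof.
move=> d0; rewrite (fsbigE (iota 0 m.+1)) ?iota_uniq //.
  by rewrite /index_iota subn0; apply: eq_bigl => j; rewrite in_setT.
by move=> j _; rewrite mem_iota add0n => /negP jm; apply: Delta_lt0; nia.
Qed.

(** Pascal's rule turns [Delta] into a difference at distance 2, which telescopes in steps of 2. *)
Lemma Delta1 n k : Delta n.+1 k = binz n k - binz n (k - 2).
Proof.
rewrite /Delta !binzS; have -> : k - 1 - 1 = k - 2 by lia.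
ring.
Qed.

(** Two uses of Pascal's rule leave a difference at distance 3, which telescopes in steps of 3, and
    a [Delta] for the next smaller [m]. *)
Lemma Delta2 n k : Delta n.+2 k = Delta n (k - 1) + (binz n k - binz n (k - 3)).
Proof.
rewrite /Delta !binzS; have -> : k - 1 - 1 = k - 2 by lia.
have -> : k - 2 - 1 = k - 3 by lia.
ring.
Qed.

(** Both sides obey the recursion from (n, m) to (n-2, m-1) with increment C(n-2, m). The range [N]
    stays fixed while [m] decreases. *)
Lemma sum_Delta3 n m N : (m < N)%N -> (2 * m + 2 <= n)%N ->
  \sum_(0 <= j < N) Delta n (m%:Z - 3 * j%:Z) =
  (\sum_(j < m.+1) 'C(n - 2 * j - 2, m - j))%N%:Z.
Proof.
elim: m n => [|m IHm] [|[|n]] // mN mn; last 2 first.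
- lia.
- under eq_bigr do rewrite Delta2.
  rewrite big_split /= telescope_binz; last lia.
  rewrite sum_bin_pairs_recl PoszD addrC -IHm; [|lia..].
  by congr (_ + _); apply: eq_bigr => j _; congr Delta; lia.
under eq_bigr do rewrite Delta2.
rewrite big_split /= telescope_binz; last lia.
rewrite big_ord1 !bin0 big1 // => j _; apply: Delta_lt0; lia.
Qed.

Theorem theorem2 (m n : nat) :
  ((m <= n)%N ->
     (h n m m)%:Z = \sum_(j \in [set: nat]) Delta n (m%:Z - j%:Z) /\
     \sum_(j \in [set: nat]) Delta n (m%:Z - j%:Z) = 'C(n, m)%:Z) /\
  ((m + 1 <= n)%N ->
     (h n m (m + 1))%:Z = \sum_(j \in [set: nat]) Delta n (m%:Z - 2 * j%:Z) /\
     \sum_(j \in [set: nat]) Delta n (m%:Z - 2 * j%:Z) = 'C(n - 1, m)%:Z) /\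
  ((2 * m + 2 <= n)%N ->
     (h n m (m + 2))%:Z = \sum_(j \in [set: nat]) Delta n (m%:Z - 3 * j%:Z) /\
     \sum_(j \in [set: nat]) Delta n (m%:Z - 3 * j%:Z) =
       (\sum_(0 <= j < m.+1) 'C(n - 2 * j - 2, m - j))%N%:Z).
Proof.
split=> [mn|]; [|split=> mn].
- suff S1 : \sum_(j \in [set: nat]) Delta n (m%:Z - j%:Z) = 'C(n, m)%:Z.
    by rewrite S1 h_level.
  transitivity (\sum_(j \in [set: nat]) Delta n (m%:Z - 1%:Z * j%:Z)).
    by apply: eq_fsbigr => j _; rewrite mul1r.
  by rewrite fsum_Delta // telescope_binz // mul1n.
- suff S2 : \sum_(j \in [set: nat]) Delta n (m%:Z - 2 * j%:Z) = 'C(n - 1, m)%:Z.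
    rewrite S2; split=> //; congr Posz; apply/eqP; rewrite eqn_leq.
    by rewrite h_le_bin_pred // bin_pred_le_h.
  rewrite fsum_Delta //; case: n mn => [|n] mn; first lia.
  under eq_bigr do rewrite Delta1.
  by rewrite telescope_binz ?subn1 //; lia.
- suff S3 : \sum_(j \in [set: nat]) Delta n (m%:Z - 3 * j%:Z) =
      (\sum_(j < m.+1) 'C(n - 2 * j - 2, m - j))%N%:Z.
    rewrite S3 big_mkord; split=> //; congr Posz; apply/eqP; rewrite eqn_leq.
    by rewrite h_le_sum_bin // sum_bin_le_h.
  by rewrite fsum_Delta // sum_Delta3.
Qed.
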